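(* Let $m=d=1$, let $A:\Gamma\times\Gamma\to\Lambda$ be a nondegenerate alternating bilinear map with $\Gamma\cong\mathbb{Z}^{2}$, $\Lambda\cong\mathbb{Z}^2$, and let $A_1,A_2,L$ be the linear parts of a lift of the antiholomorphic involution of a real principal holomorphic torus bundle over a torus with associated alternating map $A$. Then the space $\mathcal{T}\mathcal{B}_A^{\mathbb{R}}(A_1,A_2,L)\cap(\mathcal{T}_1\times\mathcal{T}_1)$ is connected.
   Context: A principal holomorphic torus bundle over a torus is a principal holomorphic bundle $f:X\to Y$ over a complex torus $Y$ (of complex dimension $m$) with structure group and fibre a complex torus $T$ (of complex dimension $d$). It is real if it is given together with an antiholomorphic involution $\sigma:X\to X$. Put $\Gamma=\pi_1(Y)\cong\mathbb{Z}^{2m}$, $\Lambda=\pi_1(T)\cong\mathbb{Z}^{2d}$, $\Pi=\pi_1(X)$; there is a central extension $1\to\Lambda\to\Pi\to\Gamma\to1$, and $A(\gamma,\gamma')=\hat\gamma\hat\gamma'\hat\gamma^{-1}\hat\gamma'^{-1}\in\Lambda$ for any lifts $\hat\gamma,\hat\gamma'\in\Pi$; $A$ is alternating bilinear. $A$ is nondegenerate if $A(\gamma,\cdot)=0$ implies $\gamma=0$; equivalently $\Lambda=Z(\Pi)$. $A$ is extended $\mathbb{R}$- and $\mathbb{C}$-bilinearly. Real coordinates: the universal covering of $X$ is identified with $(\Lambda\otimes\mathbb{R})\oplus(\Gamma\otimes\mathbb{R})$ so that $g\in\Pi$ with image $\gamma\in\Gamma$ acts by $(y,x)\mapsto(y+A(x,\gamma)+l_g,\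 x+\gamma)$ with $l_g\in\Lambda$ (elements $\lambda\in\Lambda$ acting as translations of $y$ by a fixed nonzero multiple of $\lambda$, according to normalization), and, for nondegenerate $A$, a lift $\tilde\sigma$ of $\sigma$ acts by a real affine map $\tilde\sigma(y,x)=(A_1y+Lx+d_1,\ A_2x+d_2)$. The linear parts are $\mathbb{R}$-linear maps $A_1:\Lambda\otimes\mathbb{R}\to\Lambda\otimes\mathbb{R}$, $A_2:\Gamma\otimes\mathbb{R}\to\Gamma\otimes\mathbb{R}$, $L:\Gamma\otimes\mathbb{R}\to\Lambda\otimes\mathbb{R}$. They satisfy: (1) $A_1(\Lambda)\subset\Lambda$, $A_1^2=I$; (2) $A_2(\Gamma)\subset\Gamma$, $A_2^2=I$; (3) $A_1(A(x,\gamma))=A(A_2x,A_2\gamma)$ for all $x\in\Gamma\otimes\mathbb{R}$, $\gamma\in\Gamma$; (4) $L'(x)=Lx-A(d_2,A_2x)$ satisfies $L'(\Gamma)\subset\Lambda$; (5) $A_2d_2+d_2\in\Gamma$; (6) $Ld_2+A_1d_1+d_1\in\Lambda$; (7) there is $\gamma\in\Gamma$ with $L(A_2x)+A_1(Lx)=-A(x,\gamma)$ for all $x\in\Gamma\otimes\mathbb{R}$. $\mathcal{T}\mathcal{B}_A^{\mathbb{R}}(A_1,A_2,L)$ is the set of pairs $(V,U)$, with $V\subset\Gamma\otimes\mathbb{C}$ a complex subspace of dimension $m$ and $U\subset\Lambda\otimes\mathbb{C}$ a complex subspace of dimension $d$ (topologized as a subset of a product of Grassmannians), such that $V\cap\overline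 V=0$, $U\cap\overline U=0$ and, with respect to $\Gamma\otimes\mathbb{C}=V\oplus\overline V$ and $\Lambda\otimes\mathbb{C}=U\oplus\overline U$: the component of $A$ in $\Lambda^2(\overline V)^\vee\otimes U$ is zero; the component of $A_1$ in $U^\vee\otimes U$ is zero; the component of $A_2$ in $V^\vee\otimes V$ is zero; the component of $L$ in $V^\vee\otimes U$ is zero. $\mathcal{T}_m$ is the set of $m$-dimensional complex subspaces $V\subset\Gamma\otimes\mathbb{C}$ with $V\cap\overline V=0$ whose complex orientation induces, via $\Gamma\cong p_V(\Gamma)$ ($p_V$ the projection onto $V$ with kernel $\overline V$), a fixed orientation of $\Gamma$; $\mathcal{T}_d$ is defined in the same way from $\Lambda$ with a fixed orientation (so in $\mathcal{T}_1\times\mathcal{T}_1$ the first factor refers to $\Gamma$, the second to $\Lambda$). The empty set is regarded as connected. *)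

(* Defs.v *)
From HB Require Import structures.
From mathcomp Require Import all_boot all_order all_algebra complex.
From mathcomp Require Import all_classical all_reals all_analysis.
From mathcomp Require Import ring lra.
Export numFieldNormedType.Exports.

Set Implicit Arguments.
Unset Strict Implicit.
Unset Printing Implicit Defensive.
Import Order.TTheory GRing.Theory Num.Theory.
Local Open Scope classical_set_scope.
Local Open Scope ring_scope.

(* Bases of the lattices are fixed: Gamma = Z^(2m) and Lambda = Z^(2d) are
   spaces of integer row vectors, and linear maps are matrices acting on row
   vectors from the right, as usual in MathComp.                             *)

(* R[i] under a name of type numClosedFieldType: this is what gives access to
   the topology and to the normed-module structures on 'M[Cx R]_(k, n).      *)
Definition Cx (R : realType) : numClosedFieldType := R[i].

Definition cconj (R : realType) k n (M : 'M[Cx R]_(k, n)) : 'M[Cx R]_(k, n) :=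
  map_mx (@conjc R) M.

Definition to_Cx (R : realType) k n (M : 'M[R]_(k, n)) : 'M[Cx R]_(k, n) :=
  map_mx (real_complex R) M.

Definition of_int (K : pzRingType) n (v : 'rV[int]_n) : 'rV[K]_n :=
  map_mx intr v.

Section Alternating.
Variables a b : nat.
Implicit Type A : 'rV[int]_a -> 'rV[int]_a -> 'rV[int]_b.

Definition alternating_bilinear A : Prop :=
  [/\ forall v, {morph A v : x y / x + y},
      forall v, {morph A^~ v : x y / x + y} &
      forall v, A v v = 0].

Definition is_nondegenerate A : Prop :=
  forall v, (forall w, A v w = 0) -> v = 0.

Definition bilin_ext (K : pzRingType) A (x y : 'rV[K]_a) : 'rV[K]_b :=
  \sum_i \sum_j (x 0 i * y 0 j) *: of_int K (A (delta_mx 0 i) (delta_mx 0 j)).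

Variable K : pzRingType.

Lemma bilin_extDl A x y z :
  @bilin_ext K A (x + y) z = bilin_ext A x z + bilin_ext A y z.
Proof.
rewrite /bilin_ext -big_split; apply: eq_bigr => i _.
by rewrite -big_split; apply: eq_bigr => j _ /=; rewrite !mxE mulrDl scalerDl.
Qed.

Lemma bilin_ext0l A z : @bilin_ext K A 0 z = 0.
Proof. by apply: (addrI (bilin_ext A 0 z)); rewrite -bilin_extDl !addr0. Qed.

Lemma bilin_ext0r A z : @bilin_ext K A z 0 = 0.
Proof.
by rewrite /bilin_ext big1 // => i _; rewrite big1 // => j _;
   rewrite !mxE mulr0 scale0r.
Qed.

End Alternating.

Lemma of_int0 (K : pzRingType) n : of_int K (0 : 'rV_n) = 0.
Proof. by apply/matrixP => i j; rewrite !mxE. Qed.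

Lemma of_intN (K : pzRingType) n (v : 'rV_n) : of_int K (- v) = - of_int K v.
Proof. by apply/matrixP => i j; rewrite !mxE mulrNz. Qed.

Lemma of_intZ (K : pzRingType) n c (v : 'rV_n) :
  of_int K (c *: v) = c%:~R *: of_int K v.
Proof. by apply/matrixP => i j; rewrite !mxE intrM. Qed.

Lemma bilin_extNr (K : pzRingType) a b (A : 'rV_a -> 'rV_a -> 'rV_b) x y :
  @bilin_ext a b K A x (- y) = - bilin_ext A x y.
Proof.
rewrite /bilin_ext -sumrN; apply: eq_bigr => i _; rewrite -sumrN.
by apply: eq_bigr => j _; rewrite !mxE mulrN scaleNr.
Qed.

(* Grassmannians, with the quotient topology of the space of k x n matrices of
   rank k under "span of the rows"                                           *)

Definition grassmannian (R : realType) k n :=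
  {V : {vspace 'rV[Cx R]_n} | \dim V == k}.

Section Grassmannian.
Variables (R : realType) (k n : nat).

Definition frames : set 'M[Cx R]_(k, n) := [set M | row_free M].

Definition row_span (M : 'M[Cx R]_(k, n)) : {vspace 'rV[Cx R]_n} :=
  <<[seq row i M | i <- enum 'I_k]>>%VS.

Lemma dim_row_span M : row_free M -> \dim (row_span M) == k.
Proof.
move=> Mfree; rewrite /row_span.
set s := [seq _ | _ <- _].
have sz : size s == k by rewrite size_map size_enum_ord.
have : free (Tuple sz).
  apply/freeP => c c0 i.
  pose u : 'rV[Cx R]_k := \row_j c j.
  have uM : u *m M = 0.
    rewrite mulmx_sum_row -[RHS]c0; apply: eq_bigr => j _.
    rewrite mxE (nth_map j) ?size_enum_ord //; congr (_ *: row _ _).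
    by apply: val_inj; rewrite /= nth_enum_ord.
  have /(congr1 (fun v : 'rV[Cx R]_k => v 0 i)) : u = 0.
    by apply: (row_free_inj Mfree); rewrite uM mul0mx.
  by rewrite !mxE.
by rewrite /free (eqP sz).
Qed.

Definition span_frame (M : frames) : grassmannian R k n :=
  exist _ (row_span (val M)) (dim_row_span (set_mem (valP M))).

Definition grassmannian_open (G : set (grassmannian R k n)) : Prop :=
  open (span_frame @^-1` G).

HB.instance Definition _ := Choice.on (grassmannian R k n).

Lemma grassmannian_openT : grassmannian_open setT.
Proof. by rewrite /grassmannian_open preimage_setT; exact: openT. Qed.

Lemma grassmannian_openI : setI_closed grassmannian_open.
Proof. by move=> G H oG oH; exact: openI. Qed.

Lemma grassmannian_open_bigU (I : Type) (f : I -> set (grassmannian R k n)) :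
  (forall i, grassmannian_open (f i)) -> grassmannian_open (\bigcup_i f i).
Proof. by move=> of_; apply: bigcup_open => i _; exact: of_. Qed.

HB.instance Definition _ := isOpenTopological.Build (grassmannian R k n)
  grassmannian_openT grassmannian_openI grassmannian_open_bigU.

End Grassmannian.

(* Complex structures on R^n given by subspaces V of C^n *)

Section ComplexStructures.
Variables (R : realType) (n : nat).
Implicit Types V : {vspace 'rV[Cx R]_n}.

Definition conjv V : {vspace 'rV[Cx R]_n} :=
  <<[seq cconj v | v <- vbasis V]>>%VS.

Lemma cconjK k p : involutive (@cconj R k p).
Proof. by move=> M; apply/matrixP => i j; rewrite !mxE conjcK. Qed.

Lemma cconj_sum k p I (s : seq I) (F : I -> 'M[Cx R]_(k, p)) :
  cconj (\sum_(i <- s) F i) = \sum_(i <- s) cconj (F i).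
Proof.
apply: (big_morph (@cconj R k p)) => [M N|]; apply/matrixP => i j.
  by rewrite !mxE; exact: (rmorphD (@conjc R)).
by rewrite !mxE; exact: (rmorph0 (@conjc R)).
Qed.

Lemma cconjZ k p a (M : 'M[Cx R]_(k, p)) :
  cconj (a *: M) = conjc a *: cconj M.
Proof. by apply/matrixP => i j; rewrite !mxE; exact: (rmorphM (@conjc R)). Qed.

Lemma mem_conjv V v : (v \in conjv V) = (cconj v \in V).
Proof.
have sub (W : {vspace 'rV[Cx R]_n}) w : w \in W -> cconj w \in conjv W.
  move=> /coord_vbasis ->; rewrite cconj_sum; apply: rpred_sum => i _.
  rewrite cconjZ; apply/rpredZ/memv_span.
  by apply/map_f/mem_nth; rewrite size_tuple.
apply/idP/idP => [vV|/sub]; last by rewrite cconjK.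
rewrite (coord_span (X := in_tuple _) vV) cconj_sum.
apply: rpred_sum => i _.
rewrite cconjZ; apply/rpredZ.
have /mapP[w wV ->] : (in_tuple [seq cconj v0 | v0 <- vbasis V])`_i \in
    [seq cconj v0 | v0 <- vbasis V] by apply: mem_nth.
by rewrite cconjK; exact: vbasis_mem.
Qed.

Definition is_complex_structure V : Prop := (V :&: conjv V)%VS = 0%VS.

(* the projection p_V onto V with kernel conjv V *)
Definition proj10 V : 'End('rV[Cx R]_n) := daddv_pi V (conjv V).

End ComplexStructures.

(* An orientation of Z^(2m) is a boolean: false for that of the standard basis,
   true for the opposite one. The rows 2j and 2j+1 of X below are the real
   vectors which p_V sends to b_j and i * b_j, so that the rows of X form the
   ordered basis b_0, i b_0, ..., b_(m-1), i b_(m-1) transported by p_V.     *)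
Definition induces_orientation (R : realType) m (o : bool)
    (V : {vspace 'rV[Cx R]_m.*2}) : Prop :=
  exists (b : m.-tuple 'rV[Cx R]_m.*2) (X : 'M[R]_m.*2),
    [/\ basis_of V b,
        forall i, proj10 V (to_Cx (row i X)) = 'i ^+ odd i *: b`_(i./2)
      & 0 < (-1) ^+ o * \det X].

Definition Teich (R : realType) m (o : bool) : set (grassmannian R m m.*2) :=
  [set V | is_complex_structure (val V) /\ induces_orientation o (val V)].

Definition TBR (R : realType) m d
    (A : 'rV[int]_m.*2 -> 'rV[int]_m.*2 -> 'rV[int]_d.*2)
    (A1 : 'M[R]_d.*2) (A2 : 'M[R]_m.*2) (L : 'M[R]_(m.*2, d.*2)) :
    set (grassmannian R m m.*2 * grassmannian R d d.*2) :=
  [set VU | let V := val VU.1 in let U := val VU.2 in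
    [/\ is_complex_structure V /\ is_complex_structure U,
        forall v w, v \in conjv V -> w \in conjv V ->
          proj10 U (bilin_ext A v w) = 0,
        forall u, u \in U -> proj10 U (u *m to_Cx A1) = 0,
        forall v, v \in V -> proj10 V (v *m to_Cx A2) = 0 &
        forall v, v \in V -> proj10 U (v *m to_Cx L) = 0]].

(* Real principal holomorphic torus bundles X -> Y, described on the universal
   covering (Lambda (x) R) + (Gamma (x) R) of X                              *)

Section Bundles.
Variables (R : realType) (m d : nat).

Local Notation cover := ('rV[R]_d.*2 * 'rV[R]_m.*2)%type.
Local Notation Ccover := ('rV[Cx R]_d * 'rV[Cx R]_m)%type.

Variable A : 'rV[int]_m.*2 -> 'rV[int]_m.*2 -> 'rV[int]_d.*2.

(* g = (l, gamma) acts by (y, x) |-> (y + A(x, gamma) + l, x + gamma) *)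
Definition deck (g : 'rV[int]_d.*2 * 'rV[int]_m.*2) (p : cover) : cover :=
  (p.1 + bilin_ext A p.2 (of_int R g.2) + of_int R g.1, p.2 + of_int R g.2).

(* Pi is the group of deck transformations of X, i.e. Pi = pi_1(X): an extension
   of Gamma by Lambda, where lambda in Lambda acts as the translation of y by
   c * lambda, and with commutator map A. (The last clause forces c = -2 as soon
   as A is not 0.)                                                           *)
Record is_deck_group (Pi : set ('rV[int]_d.*2 * 'rV[int]_m.*2)) : Prop := {
  deck_comp : forall g h, Pi g -> Pi h ->
    exists2 k, Pi k & deck k =1 deck g \o deck h;
  deck_inv : forall g, Pi g -> exists2 h, Pi h & cancel (deck g) (deck h);
  deck_base : forall gamma, exists l, Pi (l, gamma);
  deck_fibre : exists2 c : int, c != 0 &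
    (forall l, Pi (l, 0) <-> exists lambda, l = c *: lambda) /\
    (forall g h, Pi g -> Pi h ->
      deck g \o deck h =1 deck (c *: A g.2 h.2, 0) \o (deck h \o deck g)) }.

(* PG is the period matrix of Y = C^m / Gamma, and c * PL that of the fibre
   T = C^d / Lambda, c as in deck_fibre. A holomorphic trivialisation of the principal bundle over
   an open subset W of the universal covering of Y is T-equivariant, hence it is
   of the form y |-> PL y + psi(x) on the fibre over x.                      *)
Definition chart (PL : 'M[Cx R]_(d.*2, d)) (PG : 'M[Cx R]_(m.*2, m))
    (psi : 'rV[R]_m.*2 -> 'rV[Cx R]_d) (p : cover) : Ccover :=
  (to_Cx p.1 *m PL + psi p.2, to_Cx p.2 *m PG).

(* f is near p holomorphic, resp. antiholomorphic, when read in the charts c at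
   the source and c' at the target; these are differentiability conditions at a
   single point, imposed below at all points of an open set.                 *)
Definition C_diff_in (c c' : cover -> Ccover) (f : cover -> cover) p : Prop :=
  exists2 F : Ccover -> Ccover,
    differentiable F (c p) & \forall q \near p, c' (f q) = F (c q).

Definition antiC_diff_in (c c' : cover -> Ccover) (f : cover -> cover) p :
    Prop :=
  exists2 F : Ccover -> Ccover, differentiable F (c p) &
    \forall q \near p, c' (f q) = (cconj (F (c q)).1, cconj (F (c q)).2).

(* The identity belongs to Pi, so that the last clause makes the changes of
   trivialisation holomorphic, and the action of Pi as well.                 *)
Record is_hol_atlas (Pi : set ('rV[int]_d.*2 * 'rV[int]_m.*2))
    (PL : 'M[Cx R]_(d.*2, d)) (PG : 'M[Cx R]_(m.*2, m))
    (atlas : set (set 'rV[R]_m.*2 * ('rV[R]_m.*2 -> 'rV[Cx R]_d))) : Prop := {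
  fibre_periods : bijective (fun y : 'rV[R]_d.*2 => to_Cx y *m PL);
  base_periods : bijective (fun x : 'rV[R]_m.*2 => to_Cx x *m PG);
  atlas_open : forall t, atlas t -> open t.1;
  atlas_cont : forall t, atlas t -> {within t.1, continuous t.2};
  atlas_cover : forall x, exists2 t, atlas t & t.1 x;
  atlas_hol : forall g s t p, Pi g -> atlas s -> atlas t ->
    s.1 p.2 -> t.1 (deck g p).2 ->
    C_diff_in (chart PL PG s.2) (chart PL PG t.2) (deck g) p }.

Definition affine_map (A1 : 'M[R]_d.*2) (A2 : 'M[R]_m.*2)
    (L : 'M[R]_(m.*2, d.*2)) (d1 : 'rV[R]_d.*2) (d2 : 'rV[R]_m.*2)
    (p : cover) : cover :=
  (p.1 *m A1 + p.2 *m L + d1, p.2 *m A2 + d2).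

Record is_involution_lift (Pi : set ('rV[int]_d.*2 * 'rV[int]_m.*2))
    (PL : 'M[Cx R]_(d.*2, d)) (PG : 'M[Cx R]_(m.*2, m))
    (atlas : set (set 'rV[R]_m.*2 * ('rV[R]_m.*2 -> 'rV[Cx R]_d)))
    (s : cover -> cover) : Prop := {
  lift_desc : forall g, Pi g -> exists2 h, Pi h & s \o deck g =1 deck h \o s;
  lift_invol : exists2 h, Pi h & s \o s =1 deck h;
  lift_antihol : forall t t' p, atlas t -> atlas t' ->
    t.1 p.2 -> t'.1 (s p).2 ->
    antiC_diff_in (chart PL PG t.2) (chart PL PG t'.2) s p }.

Definition real_bundle_linear_parts (A1 : 'M[R]_d.*2) (A2 : 'M[R]_m.*2)
    (L : 'M[R]_(m.*2, d.*2)) : Prop :=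
  exists Pi PL PG atlas d1 d2,
    [/\ is_deck_group Pi, is_hol_atlas Pi PL PG atlas &
        is_involution_lift Pi PL PG atlas (affine_map A1 A2 L d1 d2)].

Let entD k n (M N : 'M[R]_(k, n)) i j : (M + N) i j = M i j + N i j.
Proof. by rewrite mxE. Qed.

Let entN k n (M : 'M[R]_(k, n)) i j : (- M) i j = - M i j.
Proof. by rewrite mxE. Qed.

Local Ltac ent H :=
  let i := fresh in let j := fresh in
  apply/matrixP => i j; move/matrixP/(_ i j): H; rewrite ?(entD, entN) => H.

Local Notation B := (@bilin_ext _ _ R A).
Local Notation r v := (of_int R v).

Lemma linear_parts_relations A1 A2 L Pi PL PG atlas d1 d2 :
  is_deck_group Pi ->
  is_involution_lift Pi PL PG atlas (affine_map A1 A2 L d1 d2) ->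
  [/\ (forall l, exists l', r l *m A1 = r l') /\ A1 *m A1 = 1%:M,
      (forall g, exists g', r g *m A2 = r g') /\ A2 *m A2 = 1%:M,
      (forall x g, B x (r g) *m A1 = B (x *m A2) (r g *m A2)),
      (forall g, exists l, r g *m L - B d2 (r g *m A2) = r l) &
      [/\ exists g, d2 *m A2 + d2 = r g,
          exists l, d2 *m L + d1 *m A1 + d1 = r l &
          exists g, forall x, x *m A2 *m L + x *m L *m A1 = - B x (r g)]].
Proof.
move=> [_ _ base [c c0 [fib _]]] [desc [[hl hg] _ hE] _].
have D2 l g : Pi (l, g) -> exists2 h, Pi h & [/\ r g *m A2 = r h.2,
   r l *m A1 + r g *m L = B d2 (r h.2) + r h.1 &
   forall x, B x (r g) *m A1 = B (x *m A2) (r h.2)].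
  move=> Plg; have [[l' g'] Ph E] := desc _ Plg; exists (l', g') => //=.
  have e2 : r g *m A2 = r g'.
    have := congr1 snd (E (0,0)); rewrite /= add0r !mul0mx !add0r.
    by rewrite addrC => /addrI.
  have e1 : r l *m A1 + r g *m L = B d2 (r g') + r l'.
    have := congr1 fst (E (0,0)); rewrite /= bilin_ext0l !mul0mx !add0r.
    by move=> H; ent H; lra.
  split => // x.
  have := congr1 fst (E (0,x)); rewrite /= !add0r !mul0mx !add0r bilin_extDl !mulmxDl => H.
  apply/matrixP => i j; move/matrixP/(_ i j): H; move/matrixP/(_ i j): e1; rewrite ?(entD,entN); lra.
have sq2 x : x *m A2 *m A2 + d2 *m A2 + d2 = x + r hg.
  by have := congr1 snd (hE (0,x)); rewrite /= mulmxDl.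
have sq1 y x : (y *m A1 + x *m L + d1) *m A1 + (x *m A2 + d2) *m L + d1 = y + B x (r hg) + r hl.
  exact: (congr1 fst (hE (y,x))).
have d2g : d2 *m A2 + d2 = r hg by have := sq2 0; rewrite !mul0mx !add0r.
have d1l : d2 *m L + d1 *m A1 + d1 = r hl.
  by have := sq1 0 0; rewrite !mul0mx !add0r bilin_ext0l add0r => <-; congr (_ + _); rewrite addrC.
have A1int l : exists l', r l *m A1 = r l'.
    have [|[l' g'] Ph /= [e2 e1 _]] := D2 (c *: l) 0; first by apply/fib; exists l.
    move: e2; rewrite of_int0 mul0mx => e2; have g0 : g' = 0.
      by apply/matrixP => i j; move/matrixP/(_ i j): e2; rewrite !mxE => /esym/eqP; rewrite intr_eq0 => /eqP.
    move: Ph; rewrite g0 => /fib [l'' El]; exists l''.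
    move: e1; rewrite g0 of_int0 mul0mx addr0 bilin_ext0r add0r El !of_intZ -scalemxAl => /scalerI; apply.
    by rewrite intr_eq0.
split.
- split=> //.
  apply/row_matrixP => i; rewrite !rowE mulmx1 mulmxA.
  have := sq1 (delta_mx 0 i) 0; rewrite !mul0mx bilin_ext0l !add0r !addr0 -d1l mulmxDl.
  move=> H; ent H; lra.
- split=> [g|].
    by have [l /D2 [h _ [e _ _]]] := base g; exists h.2.
  apply/row_matrixP => i; rewrite !rowE mulmx1 mulmxA.
  by have := sq2 (delta_mx 0 i); rewrite -d2g addrA => /addIr /addIr.
- move=> x g; have [l /D2 [h _ [-> _ e]]] := base g; exact: e.
- move=> g; have [l Pl] := base g; have [h _ [-> e1 _]] := D2 _ _ Pl.
  have [l1 E] := A1int l; exists (h.1 - l1); move: e1; rewrite E.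
  have -> : r (h.1 - l1) = r h.1 - r l1 by apply/matrixP => k j; rewrite !mxE intrD mulrNz.
  move=> H; ent H; lra.
- split; [by exists hg | by exists hl | exists (- hg) => x].
  rewrite of_intN bilin_extNr opprK.
  have := sq1 0 x; rewrite mul0mx !add0r !mulmxDl -d1l.
  move=> H; ent H; lra.
Qed.

End Bundles.

(* Main.v *)
Require Import Defs.
From mathcomp Require Import all_boot all_order all_algebra complex.
From mathcomp Require Import all_classical all_reals all_analysis.
From mathcomp Require Import ring lra.

(** Here V and U are complex lines in C^2, and a line is spanned by a vector
    v = x + i y with x, y real; it is a complex structure exactly when x and y
    are linearly independent, and the sign of det (x, y) determines the orientation.

    The condition on A2 says that A2 maps V to its conjugate. As A2 is an
    involution, multiplying v by a suitable complex number gives v A2 = conj v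
    ([adapted_frame]), i.e. x is fixed by A2 and y is changed into -y. Since both
    eigenspaces of A2 are then lines, another V' in the same Teichmueller space
    is spanned by x + i e^s y for some real s ([adapted_unique_up_to_exp]): the
    lines V, considered without L, form one copy of the real line. In the same
    way the lines U are spanned by the z + i e^r w, where U is spanned by
    z + i w and z, w are eigenvectors of A1.

    The condition on A holds on these pairs, because A is alternating and
    conj V is a line. There remains the one on L, that (x + i e^s y) L belongs
    to the line of z - i e^r w. Subtracting the same condition at s = r = 0 gives
       (e^(s+r) - 1) det (y L, w) = 0   and   (e^s - e^r) det (y L, z) = 0,
    and each of these two equations is either void or equivalent to a linear
    equation, s + r = 0 or s = r. Hence with (s, r) the whole line of all
    (t s, t r) satisfies it, and the path (V_t, U_t) given by the points
    (t s, t r) joins the two given points of the space inside it. *)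

Set Implicit Arguments.
Unset Strict Implicit.
Unset Printing Implicit Defensive.
Import Order.TTheory GRing.Theory Num.Theory.
Local Open Scope classical_set_scope.
Local Open Scope ring_scope.

(** * Determinants of pairs of row vectors in dimension two *)

Definition wedge {K : comPzRingType} (u w : 'rV[K]_2) : K :=
  u 0 0 * w 0 1 - u 0 1 * w 0 0.

Lemma ord2P (P : 'I_2 -> Prop) : P 0 -> P 1 -> forall i, P i.
Proof.
move=> P0 P1 [[|[|//]] h].
  by rewrite (_ : Ordinal h = 0) //; apply: val_inj.
by rewrite (_ : Ordinal h = 1) //; apply: val_inj.
Qed.

Lemma row2P (K : Type) (u w : 'rV[K]_2) :
  u 0 0 = w 0 0 -> u 0 1 = w 0 1 -> u = w.
Proof. by move=> e0 e1; apply/rowP; apply: ord2P. Qed.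

Section Wedge.
Variable K : comPzRingType.
Implicit Types (u w : 'rV[K]_2) (k l : K).

Lemma wedgeZ k l u w : wedge (k *: u) (l *: w) = k * l * wedge u w.
Proof. by rewrite /wedge !mxE; ring. Qed.

Lemma wedge_diag u : wedge u u = 0.
Proof. by rewrite /wedge; ring. Qed.

Lemma det_rows (X : 'M[K]_2) : \det X = wedge (row 0 X) (row 1 X).
Proof.
rewrite (expand_det_row _ 0) !big_ord_recl big_ord0 /cofactor !det_mx11 !mxE /=.
rewrite /wedge !mxE addr0 expr0 expr1 mul1r mulN1r mulrN.
by congr (X _ _ * X _ _ - X _ _ * X _ _); apply: val_inj.
Qed.

Lemma wedge_mulmx u w (X : 'M[K]_2) :
  wedge (u *m X) (w *m X) = \det X * wedge u w.
Proof.
rewrite det_rows /wedge !mxE !big_ord_recl !big_ord0.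
rewrite (_ : lift ord0 ord0 = 1); last exact: val_inj.
by rewrite (_ : ord0 = 0) //; ring.
Qed.

End Wedge.

Lemma mem_line (K : fieldType) (u w : 'rV[K]_2) :
  w != 0 -> (u \in <[w]>%VS) = (wedge u w == 0).
Proof.
move=> w0; apply/vlineP/eqP => [[k ->]|].
  by rewrite -{2}[w]scale1r wedgeZ wedge_diag mulr0.
rewrite /wedge => /eqP; rewrite subr_eq0 => /eqP uw.
have [w00|w00] := eqVneq (w 0 0) 0.
  have w01 : w 0 1 != 0.
    by apply: contraNneq w0 => w01; apply/eqP/row2P; rewrite !mxE.
  exists (u 0 1 / w 0 1); apply: row2P; rewrite !mxE; last by rewrite divfK.
  by apply: (mulIf w01); rewrite uw w00 !mulr0 mul0r.
exists (u 0 0 / w 0 0); apply: row2P; rewrite !mxE; first by rewrite divfK.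
by apply: (mulIf w00); rewrite -uw; field.
Qed.

Lemma wedge_neq0 (K : idomainType) (u w : 'rV[K]_2) :
  wedge u w != 0 -> u != 0 /\ w != 0.
Proof.
move=> uw; split; apply: contra_neq uw => ->;
  by rewrite /wedge !mxE ?mulr0 ?mul0r subrr.
Qed.

(** An involution of the plane with both eigenvalues has determinant -1, and
    this makes the two eigenspaces isotropic for the determinant form, i.e. lines
    ([wedge_same_eigen]). *)
Lemma wedge_eigen (R : realFieldType) (X : 'M[R]_2) (x y : 'rV[R]_2) :
  x *m X = x -> y *m X = - y -> wedge x y != 0 -> \det X = -1.
Proof.
move=> xX yX xy; have := wedge_mulmx x y X.
rewrite xX yX -{1}[x]scale1r -scaleN1r wedgeZ mul1r => e.
by apply: (mulIf xy).
Qed.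

Lemma wedge_same_eigen (R : realFieldType) (X : 'M[R]_2) (u w : 'rV[R]_2) k :
  \det X = -1 -> k * k = 1 -> u *m X = k *: u -> w *m X = k *: w ->
  wedge u w = 0.
Proof.
move=> dX kk uX wX; have := wedge_mulmx u w X.
rewrite uX wX wedgeZ kk dX; lra.
Qed.

(** * Lines spanned by a complex vector with given real and imaginary parts *)

Section Frames.
Variable R : realType.
Implicit Types (x y : 'rV[R]_2) (v : 'rV[Cx R]_2).

Definition frame x y : 'rV[Cx R]_2 := \row_j (x 0 j +i* y 0 j)%C.

Lemma frameP v : exists x y, v = frame x y.
Proof.
exists (\row_j complex.Re (v 0 j)), (\row_j complex.Im (v 0 j)).
by apply/rowP => j; rewrite !mxE; case: (v 0 j).
Qed.

Lemma frame_inj x y x' y' : frame x y = frame x' y' -> x = x' /\ y = y'.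
Proof.
move=> e; split; apply/rowP => j; have /rowP/(_ j) := e; rewrite !mxE;
  by case.
Qed.

Lemma frame0 x y : frame x y = 0 -> x = 0 /\ y = 0.
Proof.
move=> e; apply: frame_inj; rewrite e.
by apply/rowP => j; rewrite !mxE.
Qed.

Lemma cconj_frame x y : cconj (frame x y) = frame x (- y).
Proof. by apply/rowP => j; rewrite !mxE. Qed.

Lemma frameD x y x' y' : frame x y + frame x' y' = frame (x + x') (y + y').
Proof. by apply/rowP => j; rewrite !mxE. Qed.

Lemma frameZ (a b : R) x y :
  (a +i* b)%C *: frame x y = frame (a *: x - b *: y) (b *: x + a *: y).
Proof.
apply/rowP => j; rewrite !mxE; apply/eqP; rewrite eq_complex /=.
by apply/andP; split; apply/eqP; ring.
Qed.

Lemma to_CxE x : to_Cx x = frame x 0.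
Proof. by apply/rowP => j; rewrite !mxE. Qed.

Lemma frame_mulmx x y (X : 'M[R]_2) :
  frame x y *m to_Cx X = frame (x *m X) (y *m X).
Proof.
apply/rowP => j; rewrite !mxE !big_ord_recl !big_ord0 !mxE.
by apply/eqP; rewrite eq_complex /=; apply/andP; split; apply/eqP; ring.
Qed.

Lemma wedge_frame x y x' y' :
  wedge (frame x y) (frame x' y') =
  ((wedge x x' - wedge y y') +i* (wedge x y' + wedge y x'))%C.
Proof.
rewrite /wedge !mxE; apply/eqP; rewrite eq_complex /=.
by apply/andP; split; apply/eqP; ring.
Qed.

Lemma frame_neq0 x y : wedge x y != 0 -> frame x y != 0.
Proof. by move=> /wedge_neq0[x0 _]; apply: contra_neq x0 => /frame0[]. Qed.

Lemma conjv_line v : conjv <[v]>%VS = <[cconj v]>%VS.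
Proof.
apply/vspaceP => u; rewrite mem_conjv; apply/vlineP/vlineP => -[k e];
  exists (conjc k).
  by rewrite -[u]cconjK e cconjZ.
by rewrite e cconjZ cconjK.
Qed.

(** The determinant of x + i y and its conjugate x - i y is -2 i det (x, y). *)
Lemma complex_structure_line x y : frame x y != 0 ->
  is_complex_structure <[frame x y]>%VS <-> wedge x y != 0.
Proof.
move=> v0; rewrite /is_complex_structure conjv_line cconj_frame.
have memc u : (u \in <[frame x (- y)]>%VS) = (wedge u (frame x (- y)) == 0).
  apply: mem_line; apply: contra_neq v0 => /frame0 [-> /eqP].
  by rewrite oppr_eq0 => /eqP ->; rewrite -to_CxE; apply/rowP => j; rewrite !mxE.
have E : (wedge (frame x y) (frame x (- y)) == 0) = (wedge x y == 0).
  rewrite wedge_frame eq_complex /= /wedge !mxE.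
  apply/andP/eqP => [[_ /eqP]|h]; first lra.
  by split; apply/eqP; lra.
split=> [cap0|xy].
  apply: contra_neqN v0; rewrite -E -memc => m.
  by apply/eqP; rewrite -memv0 -cap0 memv_cap memv_line.
apply/eqP; rewrite -subv0; apply/subvP => u.
rewrite memv_cap => /andP[/vlineP[k ->]].
rewrite memc -[frame x (- y)]scale1r wedgeZ.
by rewrite mulr1 mulf_eq0 E (negbTE xy) orbF => /eqP ->; rewrite scale0r mem0v.
Qed.

End Frames.

(** * Projections and orientations of complex structures on the plane *)

Section Structures.
Variable R : realType.
Implicit Types (x y : 'rV[R]_2) (v u w : 'rV[Cx R]_2).

Lemma proj10_conjv n (V : {vspace 'rV[Cx R]_n}) (u : 'rV[Cx R]_n) :
  is_complex_structure V -> u \in conjv V -> proj10 V u = 0.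
Proof.
move=> cV uV; have uVV : u \in (V + conjv V)%VS.
  by apply: (subvP (addvSr _ _)).
have := daddv_pi_add cV uVV; rewrite (daddv_pi_id _ uV); last by rewrite capvC.
by move/eqP; rewrite addrC -subr_eq0 addrAC subrr add0r => /eqP.
Qed.

(** A nonzero determinant of x and y makes the plane the sum of the line and its
    conjugate, so that the kernel of the projection is the conjugate line, here
    expressed by a determinant. *)
Lemma proj10_line x y u : wedge x y != 0 ->
  proj10 <[frame x y]>%VS u = 0 <-> wedge u (frame x (- y)) = 0.
Proof.
move=> xy; have v0 := frame_neq0 xy.
have cV : is_complex_structure <[frame x y]>%VS.
  by apply/complex_structure_line.
have v0' : frame x (- y) != 0.
  apply: frame_neq0; rewrite -[x]scale1r -scaleN1r wedgeZ.
  by rewrite mul1r mulN1r oppr_eq0.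
have conjE : (u \in conjv <[frame x y]>%VS) = (wedge u (frame x (- y)) == 0).
  by rewrite conjv_line cconj_frame mem_line.
split=> [pu0|/eqP]; last by rewrite -conjE; exact: proj10_conjv.
have full : u \in (<[frame x y]> + conjv <[frame x y]>)%VS.
  have -> : (<[frame x y]> + conjv <[frame x y]>)%VS = fullv.
    apply/eqP; rewrite eqEdim subvf dimvf /dim /= dimv_disjoint_sum //.
    by rewrite conjv_line cconj_frame !dim_vline v0 v0'.
  exact: memvf.
apply/eqP; rewrite -conjE; have := daddv_pi_add cV full.
by rewrite -/(proj10 _) pu0 add0r => <-; exact: memv_pi.
Qed.

Lemma wedge_basis0 x y (z : 'rV[R]_2) :
  wedge x y != 0 -> wedge z x = 0 -> wedge z y = 0 -> z = 0.
Proof.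
move=> xy zx zy; apply/rowP => j; apply: (mulIf xy); rewrite mxE mul0r.
have -> : z 0 j * wedge x y = wedge z y * x 0 j - wedge z x * y 0 j.
  by move: j; apply: ord2P; rewrite /wedge; ring.
by rewrite zx zy !mul0r subrr.
Qed.

(** A real vector is the sum of its projection onto the line and of the complex
    conjugate of that projection, hence twice the real part of the latter. *)
Lemma proj10_real x y (r p q : 'rV[R]_2) :
  wedge x y != 0 -> frame p q \in <[frame x y]>%VS ->
  proj10 <[frame x y]>%VS (to_Cx r) = frame p q <-> r = 2 *: p.
Proof.
move=> xy pqV; have cV : is_complex_structure <[frame x y]>%VS.
  by apply/complex_structure_line => //; apply: frame_neq0.
have p2 : proj10 <[frame x y]>%VS (to_Cx (2 *: p)) = frame p q.
  have -> : to_Cx (2 *: p) = frame p q + frame p (- q).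
    by rewrite frameD subrr to_CxE scaler_nat mulr2n.
  rewrite linearD /= [X in X + _](daddv_pi_id cV pqV) proj10_conjv ?addr0 //.
  by rewrite mem_conjv cconj_frame opprK.
split=> [rE|->//]; apply/eqP; rewrite -subr_eq0; apply/eqP.
have : proj10 <[frame x y]>%VS (to_Cx (r - 2 *: p)) = 0.
  have -> : to_Cx (r - 2 *: p) = to_Cx r - to_Cx (2 *: p).
    by rewrite !to_CxE; apply/rowP => j; rewrite !mxE; simpc.
  by rewrite linearB /= rE p2 subrr.
move/(proj10_line _ xy); rewrite to_CxE wedge_frame => -[e1 e2].
apply: (wedge_basis0 xy); move: e1 e2; rewrite /wedge !mxE; lra.
Qed.

(** Projection onto the line sends 2 x to x + i y and -2 y to i (x + i y), which
    explains the sign; any other basis vector is k (x + i y), and this multiplies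
    the determinant by |k|^2 > 0. *)
Lemma orientation_line (o : bool) x y : wedge x y != 0 ->
  @induces_orientation R 1 o <[frame x y]>%VS <->
  0 < (-1) ^+ o * - wedge x y.
Proof.
move=> xy; have v0 := frame_neq0 xy.
have iE : 'i = (0 +i* 1)%C :> Cx R by [].
split=> [[b [X [bV XE dX]]]|o_gt0].
  have b0V : b`_0 \in <[frame x y]>%VS.
    by rewrite -(span_basis bV) memv_span // mem_nth // size_tuple.
  have [[k l] bE] := vlineP _ _ b0V.
  have Vkl z : z *: b`_0 \in <[frame x y]>%VS by apply: rpredZ.
  have := XE 0; have := XE 1; rewrite /= expr1 expr0 scale1r.
  have := Vkl 'i; have := b0V.
  rewrite bE iE frameZ frameZ !scale0r !scale1r sub0r addr0 => V0 V1.
  move/(proj10_real _ xy V1) => r1 /(proj10_real _ xy V0) r0.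
  move: dX; rewrite det_rows r0 r1.
  have -> : wedge (2 *: (k *: x - l *: y)) (2 *: - (l *: x + k *: y)) =
      4 * (k ^+ 2 + l ^+ 2) * - wedge x y.
    by rewrite /wedge !mxE; ring.
  rewrite mulrCA => h; move: (h); rewrite pmulr_rgt0 //.
  rewrite lt0r mulr_ge0 ?addr_ge0 ?sqr_ge0 // andbT.
  by apply: contraTneq h => ->; rewrite mul0r ltxx.
exists [tuple frame x y], (\matrix_i (if odd i then (-2) *: y else 2 *: x)).
have V0 : frame x y \in <[frame x y]>%VS by apply: memv_line.
have V1 : 'i *: frame x y \in <[frame x y]>%VS by apply: rpredZ.
split.
- by rewrite /basis_of span_seq1 eqxx seq1_free.
- apply: ord2P; rewrite rowK /= ?expr0 ?scale1r ?expr1.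
    exact/(proj10_real _ xy V0).
  move: V1; rewrite iE frameZ => V1; apply/(proj10_real _ xy V1).
  by rewrite scale0r sub0r scale1r scalerN scaleNr.
- rewrite det_rows !rowK /= wedgeZ.
  by rewrite mulrN mulNr -mulrN mulrCA pmulr_rgt0 // mulr_gt0.
Qed.

End Structures.

(** * Complex structures for which a real involution is antiholomorphic *)

Section RealPoints.
Variable R : realType.
Implicit Types (x y : 'rV[R]_2) (X : 'M[R]_2) (o : bool).

(** The first two equations say (x + i y) X = x - i y. *)
Definition adapted X o x y : Prop :=
  [/\ x *m X = x, y *m X = - y & 0 < (-1) ^+ o * - wedge x y].

Lemma adapted_wedge X o x y : adapted X o x y -> wedge x y != 0.
Proof. by case=> _ _; apply: contraTneq => ->; rewrite oppr0 mulr0 ltxx. Qed.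

Lemma adapted_exp X o x y (s : R) :
  adapted X o x y -> adapted X o x (expR s *: y).
Proof.
case=> xX yX oxy; split=> //; first by rewrite -scalemxAl yX scalerN.
by rewrite -{1}[x]scale1r wedgeZ mul1r -mulrN mulrCA pmulr_rgt0 ?expR_gt0.
Qed.

Lemma vline_scale (v : 'rV[Cx R]_2) k : k != 0 -> <[k *: v]>%VS = <[v]>%VS.
Proof.
move=> k0; apply/eqP; rewrite eqEdim !dim_vline scaler_eq0 (negbTE k0) leqnn.
by rewrite andbT -memvE rpredZ // memv_line.
Qed.

(** Let v span V. The vector v + conj v X lies in V and X maps it to its
    conjugate, since X is an involution; if it is 0, then i v has this property. *)
Lemma adapted_frame X o (V : grassmannian R 1 2) :
  X *m X = 1%:M -> @Teich R 1 o V ->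
  (forall v, v \in val V -> proj10 (val V) (v *m to_Cx X) = 0) ->
  exists x y, adapted X o x y /\ val V = <[frame x y]>%VS.
Proof.
move=> XX [cV oV] antiV.
have [v v0 VE] : exists2 v, v != 0 & val V = <[v]>%VS.
  have dV : \dim (val V) = 1%N by apply/eqP; exact: (valP V).
  have v0 : vpick (val V) != 0 by rewrite vpick0 -dimv_eq0 dV.
  exists (vpick (val V)) => //; apply/esym/eqP.
  by rewrite eqEdim -memvE memv_pick dim_vline v0 dV.
have [x [y vE]] := frameP v; rewrite vE in VE v0; rewrite VE in cV oV antiV.
have xy : wedge x y != 0 by apply/complex_structure_line.
have [[a b] mE] : exists m, frame x y *m to_Cx X = m *: frame x (- y).
  apply/vlineP; rewrite mem_line; last first.
    by rewrite -cconj_frame; apply: contra_neq v0 => /(congr1 (@cconj _ _ _));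
      rewrite cconjK => ->; apply/rowP => j; rewrite !mxE; exact: rmorph0.
  by apply/eqP/(proj10_line _ xy)/antiV/memv_line.
have [xX yX] : x *m X = a *: x + b *: y /\ y *m X = b *: x - a *: y.
  move: mE; rewrite frame_mulmx frameZ => /frame_inj.
  by rewrite !scalerN opprK.
have ab1 : a ^+ 2 + b ^+ 2 = 1.
  have [x0 _] := wedge_neq0 xy.
  have : x *m X *m X = x by rewrite -mulmxA XX mulmx1.
  rewrite xX mulmxDl -!scalemxAl xX yX => e.
  have {}e : (a ^+ 2 + b ^+ 2 - 1) *: x = 0.
    rewrite scalerBl scale1r -{2}e.
    by apply/rowP => j; rewrite !mxE; ring.
  by apply/eqP; rewrite -subr_eq0; move/eqP: e; rewrite scaler_eq0 (negbTE x0) orbF.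
have [k k0 [x' [y' [kE x'X y'X]]]] : exists2 k : Cx R, k != 0 & exists x' y',
    [/\ k *: frame x y = frame x' y', x' *m X = x' & y' *m X = - y'].
  (* v + conj v X is (1 + a - i b) v, and it vanishes iff a = -1. *)
  have [am1|am1] := eqVneq a (-1).
    have b0 : b = 0.
      by apply/eqP; rewrite -sqrf_eq0; apply/eqP; move: ab1; rewrite am1; lra.
    exists (0 +i* 1)%C; first by rewrite eq_complex /= oner_eq0 andbF.
    exists (- y), x; split.
    - by rewrite frameZ !scale0r !scale1r sub0r addr0.
    - by rewrite mulNmx yX b0 am1 scale0r scaleNr scale1r sub0r opprK.
    - by rewrite xX b0 am1 scale0r scaleNr scale1r addr0.
  exists ((1 + a) +i* - b)%C.
    by rewrite eq_complex /= addrC addr_eq0 (negbTE am1).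
  exists ((1 + a) *: x - (- b) *: y), (- b *: x + (1 + a) *: y); split.
  - by rewrite frameZ.
  - rewrite mulmxBl -!scalemxAl xX yX; apply/rowP => j; rewrite !mxE.
    by have := congr1 ( *%R^~ (x 0 j)) ab1 => /=; lra.
  - rewrite mulmxDl -!scalemxAl xX yX; apply/rowP => j; rewrite !mxE.
    by have := congr1 ( *%R^~ (y 0 j)) ab1 => /=; lra.
have x'V : <[frame x y]>%VS = <[frame x' y']>%VS by rewrite -kE vline_scale.
exists x', y'; split; last by rewrite VE.
have x'y' : wedge x' y' != 0.
  apply/complex_structure_line; last by rewrite -x'V.
  by rewrite -kE scaler_eq0 negb_or k0 v0.
by split=> //; apply/orientation_line; rewrite -?x'V.
Qed.

(** The two eigenspaces of X are lines, so x' = a x and y' = b y; the orientations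
    agree, so b / a > 0 and it is an exponential. *)
Lemma adapted_unique_up_to_exp X o x y x' y' :
  adapted X o x y -> adapted X o x' y' ->
  exists s : R, <[frame x' y']>%VS = <[frame x (expR s *: y)]>%VS.
Proof.
move=> adx adx'; have xy := adapted_wedge adx; have x'y' := adapted_wedge adx'.
case: adx adx' => xX yX oxy [x'X y'X ox'y'].
have dX := wedge_eigen xX yX xy; have [x0 y0] := wedge_neq0 xy.
have [a x'E] : exists a, x' = a *: x.
  apply/vlineP; rewrite mem_line //; apply/eqP.
  by apply: (wedge_same_eigen (k := 1) dX); rewrite ?mulr1 ?scale1r.
have [b y'E] : exists b, y' = b *: y.
  apply/vlineP; rewrite mem_line //; apply/eqP.
  by apply: (wedge_same_eigen (k := -1) dX); rewrite ?mulrNN ?mulr1 ?scaleN1r.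
have ab : 0 < a * b.
  by move: ox'y'; rewrite x'E y'E wedgeZ -mulrN mulrCA pmulr_lgt0.
have a0 : a != 0 by apply: contraTneq ab => ->; rewrite mul0r ltxx.
have ba : b / a \is Num.pos.
  rewrite posrE -(pmulr_lgt0 _ (_ : 0 < a ^+ 2)) ?exprn_even_gt0 //.
  by rewrite expr2 mulrA divfK // mulrC.
exists (ln (b / a)); rewrite lnK //.
have -> : frame x' y' = (a +i* 0)%C *: frame x ((b / a) *: y).
  rewrite frameZ scale0r subr0 scale0r add0r scalerA mulrCA divff // mulr1.
  by rewrite x'E y'E.
by rewrite vline_scale // eq_complex /= (negbTE a0).
Qed.

Lemma adapted_Teich X o x y (V : grassmannian R 1 2) : adapted X o x y ->
  val V = <[frame x y]>%VS -> @Teich R 1 o V /\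
  (forall v, v \in val V -> proj10 (val V) (v *m to_Cx X) = 0).
Proof.
move=> adx VE; have xy := adapted_wedge adx; case: adx => xX yX oxy.
split; first split; rewrite VE.
- by apply/complex_structure_line; first apply: frame_neq0.
- exact/orientation_line.
- move=> v /vlineP[k ->]; rewrite -scalemxAl linearZ /=.
  suff -> : proj10 <[frame x y]>%VS (frame x y *m to_Cx X) = 0.
    by rewrite scaler0.
  by apply/(proj10_line _ xy); rewrite frame_mulmx xX yX wedge_diag.
Qed.

(** On a lattice of rank two an alternating map is a multiple of the determinant;
    in particular its extension vanishes on each complex line. *)
Lemma bilin_ext_wedge (A : 'rV[int]_2 -> 'rV[int]_2 -> 'rV[int]_2)
    (u w : 'rV[Cx R]_2) :
  alternating_bilinear A ->
  bilin_ext A u w =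
  wedge u w *: of_int (Cx R) (A (delta_mx 0 0) (delta_mx 0 1)).
Proof.
move=> [Ar Al A0].
have AN g h : A g h = - A h g.
  have := A0 (g + h); rewrite Ar Al (Al h g h) !A0 add0r addr0 => /eqP.
  by rewrite addrC addr_eq0 => /eqP.
rewrite /bilin_ext !big_ord_recl !big_ord0.
rewrite (_ : lift ord0 ord0 = 1); last exact: val_inj.
rewrite (_ : ord0 = 0) // !A0 (AN (delta_mx 0 1)) of_intN of_int0.
by apply/rowP => j; rewrite /wedge !mxE; ring.
Qed.

(** The two equations are the real and imaginary parts of the determinant of
    (x + i y) L and z - i w, whose vanishing says that L maps V to the conjugate
    of U. *)
Lemma TBR_adapted (A : 'rV[int]_2 -> 'rV[int]_2 -> 'rV[int]_2)
    (A1 A2 L : 'M[R]_2) oG oL x y z w (V U : grassmannian R 1 2) :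
  alternating_bilinear A -> adapted A2 oG x y -> adapted A1 oL z w ->
  val V = <[frame x y]>%VS -> val U = <[frame z w]>%VS ->
  @TBR R 1 1 A A1 A2 L (V, U) <->
  wedge (x *m L) z + wedge (y *m L) w = 0 /\
  wedge (x *m L) w = wedge (y *m L) z.
Proof.
move=> Aalt adx adz VE UE; have zw := adapted_wedge adz.
have [[cV _] tV] := adapted_Teich adx VE; have [[cU _] tU] := adapted_Teich adz UE.
have LE : proj10 (val U) (frame x y *m to_Cx L) = 0 <->
    wedge (x *m L) z + wedge (y *m L) w = 0 /\
    wedge (x *m L) w = wedge (y *m L) z.
  rewrite UE; apply: (iff_trans (proj10_line _ zw)).
  rewrite frame_mulmx wedge_frame /wedge !mxE.
  split=> [[]|[e1 e2]]; first lra.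
  by apply/eqP; rewrite eq_complex /=; apply/andP; split; apply/eqP; lra.
split=> [[_ _ _ _ Lc]|/LE Lc].
  by apply/LE/Lc; rewrite VE memv_line.
split=> //= [v1 v2|v]; rewrite VE.
  rewrite conjv_line => /vlineP[k1 ->] /vlineP[k2 ->].
  by rewrite (bilin_ext_wedge _ _ Aalt) wedgeZ wedge_diag mulr0 scale0r linear0.
by move=> /vlineP[k ->]; rewrite -scalemxAl linearZ /= Lc scaler0.
Qed.

End RealPoints.

(** * Connectedness *)

Section Paths.
Variable R : realType.
Implicit Types (x y : 'rV[R]_2).

(** The Grassmannian is a quotient of the space of frames, which carries the
    subspace topology. *)
Lemma continuous_span_frame (T : topologicalType) k n
    (f : T -> 'M[Cx R]_(k, n)) (f_free : forall t, row_free (f t)) :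
  continuous f ->
  continuous (fun t =>
    span_frame (exist _ (f t) (mem_set (f_free t)) : @frames R k n)).
Proof.
move=> cf; set g := fun t => _.
have cg : continuous (fun t => exist _ (f t) (mem_set (f_free t)) : @frames R k n).
  exact: continuous_comp_initial.
by apply/continuousP => G oG; have /continuousP/(_ _ oG) := cg.
Qed.

Lemma continuous_real_complex : continuous (real_complex R : R -> Cx R).
Proof.
move=> t; apply/cvgrPdist_lt => -[e e'].
rewrite ltcE /= => /andP[/eqP -> e0]; near=> s.
have -> : real_complex R t - real_complex R s = real_complex R (t - s).
  by rewrite rmorphB.
rewrite normc_def /= expr0n addr0 sqrtr_sqr ltcR.
by near: s; apply: cvgr_dist_lt.
Unshelve. all: by end_near.
Qed.

Lemma row_span_line n (v : 'rV[Cx R]_n) : row_span v = <[v]>%VS.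
Proof.
by rewrite /row_span enum_ordSl (size0nil (size_enum_ord 0)) /= row_id span_seq1.
Qed.

Lemma continuous_frame x y (s : R) :
  continuous (fun t : R => frame x (expR (t * s) *: y)).
Proof.
have -> : (fun t : R => frame x (expR (t * s) *: y)) =
    (fun t => frame x 0 + (real_complex R (expR (t * s)) : Cx R) *: frame 0 y).
  by apply/funext => t; apply/rowP => j; rewrite !mxE; simpc.
have cexp : continuous ((real_complex R : R -> Cx R) \o (expR \o *%R^~ s)).
  move=> t; apply: continuous_comp; last exact: continuous_real_complex.
  apply: continuous_comp; last exact: continuous_expR.
  exact: mulrr_continuous.
by move=> t; apply: cvgD; [exact: cvg_cst|apply: cvgZr_tmp; exact: cexp].
Qed.

Lemma line_path x y (s : R) : wedge x y != 0 ->
  exists2 g : R -> grassmannian R 1 2, continuous g &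
    forall t, val (g t) = <[frame x (expR (t * s) *: y)]>%VS.
Proof.
move=> xy.
have free t : row_free (frame x (expR (t * s) *: y)).
  rewrite /row_free rank_rV frame_neq0 //.
  by rewrite -[x]scale1r wedgeZ mul1r mulf_neq0 // lt0r_neq0 // expR_gt0.
exists (fun t => span_frame
    (exist _ (frame x (expR (t * s) *: y)) (mem_set (free t)) : @frames R 1 2)).
  exact/continuous_span_frame/continuous_frame.
by move=> t; rewrite -row_span_line.
Qed.

End Paths.

Lemma connected_joined (T : topologicalType) (S : set T) :
  (forall p q, S p -> S q ->
    exists C, [/\ connected C, C `<=` S, C p & C q]) -> connected S.
Proof.
move=> joinS; have [->|/set0P[p Sp]] := eqVneq S set0; first exact: connected0.
suff -> : S = connected_component S p by exact: component_connected.
apply/seteqP; split=> [q Sq|]; last exact: connected_component_sub.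
have [C [cC CS Cp Cq]] := joinS p q Sp Sq.
exact: (connected_component_max Cp CS cC).
Qed.

Unset Implicit Arguments.

Theorem proposition4p7 (R : realType)
    (A : 'rV[int]_2 -> 'rV[int]_2 -> 'rV[int]_2)
    (A1 A2 L : 'M[R]_2) (oGamma oLambda : bool) :
  alternating_bilinear A -> is_nondegenerate A ->
  @real_bundle_linear_parts R 1%N 1%N A A1 A2 L ->
  connected (@TBR R 1%N 1%N A A1 A2 L `&`
             (@Teich R 1%N oGamma `*` @Teich R 1%N oLambda)).
Proof.
move=> Aalt _ [Pi [PL [PG [atlas [d1 [d2 [deckPi _ liftPi]]]]]]].
have [[_ A1A1] [_ A2A2] _ _ _] := linear_parts_relations deckPi liftPi.
apply: connected_joined => -[V0 U0] [V1 U1] [S0 [/= tV0 tU0]] [S1 [/= tV1 tU1]].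
have [_ _ aU0 aV0 _] := S0; have [_ _ aU1 aV1 _] := S1.
have [x [y [adx V0E]]] := adapted_frame A2A2 tV0 aV0.
have [z [w [adz U0E]]] := adapted_frame A1A1 tU0 aU0.
have [s V1E] : exists s : R, val V1 = <[frame x (expR s *: y)]>%VS.
  have [x1 [y1 [adx1 ->]]] := adapted_frame A2A2 tV1 aV1.
  exact: (adapted_unique_up_to_exp adx adx1).
have [r U1E] : exists r : R, val U1 = <[frame z (expR r *: w)]>%VS.
  have [z1 [w1 [adz1 ->]]] := adapted_frame A1A1 tU1 aU1.
  exact: (adapted_unique_up_to_exp adz adz1).
have [g cg gE] := line_path s (adapted_wedge adx).
have [h ch hE] := line_path r (adapted_wedge adz).
move/(TBR_adapted L Aalt adx adz V0E U0E) : S0 => [S0a S0b].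
move/(TBR_adapted L Aalt (adapted_exp s adx) (adapted_exp r adz) V1E U1E) : S1.
(* The conditions on L at (k, l), reduced by those at (1, 1). *)
have scaled k l :
  (wedge (x *m L) z + wedge (k *: y *m L) (l *: w) = 0 /\
   wedge (x *m L) (l *: w) = wedge (k *: y *m L) z) <->
  ((k * l - 1) * wedge (y *m L) w = 0 /\ (k - l) * wedge (y *m L) z = 0).
  rewrite -scalemxAl wedgeZ -[in wedge (x *m L) (l *: w)](scale1r (x *m L)).
  rewrite -{2}[z]scale1r !wedgeZ mul1r mulr1 S0b.
  by split=> -[]; split; lra.
move/scaled; rewrite -expRD => -[S1a S1b].
have path t : (@TBR R 1 1 A A1 A2 L `&`
      (@Teich R 1 oGamma `*` @Teich R 1 oLambda)) (g t, h t).
  have adxt := adapted_exp (t * s) adx; have adzt := adapted_exp (t * r) adz.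
  split; last first.
    split; first by have [] := adapted_Teich adxt (gE t).
    by have [] := adapted_Teich adzt (hE t).
  apply/(TBR_adapted L Aalt adxt adzt (gE t) (hE t))/scaled.
  split.
    move/eqP: S1a; rewrite mulf_eq0 => /orP[|/eqP ->]; last by rewrite mulr0.
    rewrite subr_eq0 -(@expR0 R) => /eqP/expR_inj sr0.
    by rewrite -expRD -mulrDr sr0 mulr0 expR0 subrr mul0r.
  move/eqP: S1b; rewrite mulf_eq0 => /orP[|/eqP ->]; last by rewrite mulr0.
  by rewrite subr_eq0 => /eqP/expR_inj ->; rewrite subrr mul0r.
(* t = 0 gives the first point and t = 1 the second one. *)
exists (range (fun t : R => (g t, h t))); split.
- apply: connected_continuous_connected.
    by apply/connected_intervalP => ?.
  by apply: continuous_subspaceT => t; exact: (cvg_pair (cg t) (ch t)).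
- by move=> _ [t _ <-].
- by exists 0 => //; congr (_, _); apply: val_inj;
    rewrite /= ?gE ?hE mul0r expR0 scale1r.
- by exists 1 => //; congr (_, _); apply: val_inj; rewrite /= ?gE ?hE mul1r.
Qed.
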